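(* Let $\{a_n\}_{n\ge1}$ and $\{c_n\}_{n\ge1}$ be sequences of positive real numbers, let $\gamma\geq 1$ be a real number, and let $\{\theta_n\}_{n\ge1}$ be a bounded sequence of real numbers. (i) Suppose that there exists $\mu\in\mathbb{R}$ such that $\theta_n\geq(1-\mu)n^{\gamma-1}$ holds for all $n$ sufficiently large. If $$\frac{a_n}{a_{n+1}}\geq 1+\frac{c_{n+1}}{n}+\frac{\mu}{n}+\frac{\theta_n}{n^{\gamma}}$$ holds for all $n$ sufficiently large, then $\sum c_n a_n$ converges. (ii) Suppose that there exists $\mu\in\mathbb{R}$ such that $\theta_n\leq(1-\mu)n^{\gamma-1}$ holds for all $n$ sufficiently large. If $\sum \frac{c_n}{n}$ diverges and $$\frac{a_n}{a_{n+1}}\leq 1-\frac{c_{n+1}}{n}+\frac{\mu}{n}+\frac{\theta_n}{n^{\gamma}}$$ for all $n$ sufficiently large, then $\sum c_n a_n$ diverges. *)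

(* Defs.v *)
From Stdlib Require Import Reals.
From Coquelicot Require Import Coquelicot.
Open Scope R_scope.

(* A sequence (u_n)_{n >= 1} is encoded as a function nat -> R whose value at
   index 0 is unconstrained and never used. *)
Definition pos_seq (u : nat -> R) : Prop :=
  forall n : nat, (1 <= n)%nat -> 0 < u n.

Definition bounded_seq (u : nat -> R) : Prop :=
  exists M : R, forall n : nat, (1 <= n)%nat -> Rabs (u n) <= M.

(* The shift makes the series start at index 1. *)
Definition series_converges (u : nat -> R) : Prop :=
  ex_series (fun n : nat => u (S n)).

Definition series_diverges (u : nat -> R) : Prop := ~ series_converges u.

(* Main.v *)
Require Import Defs.
From Stdlib Require Import Reals Lra Lia.
From Coquelicot Require Import Coquelicot.
Open Scope R_scope.

(** Dividing the hypothesis on [theta n] by [n ^ gamma] turns it into a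
    comparison of [theta n / n ^ gamma] with [(1 - mu) / n], so [mu] cancels and
    both ratio conditions become statements about [u n = n * a n]:
    in (i), [c (n+1) * a (n+1) <= u n - u (n+1)], and in (ii),
    [c (n+1) * a (n+1) <= u (n+1) - u n].

    In (i) the terms of the series are thus dominated by the differences of a
    positive decreasing sequence, whose sum telescopes to a finite limit
    ([ex_series_le_decrements]).  In (ii) the sequence [u] is eventually
    increasing, hence bounded below by some [K > 0]; then
    [c n * a n >= K * (c n / n)], and the divergence of the series of [c n / n]
    is inherited. *)

Lemma Rpower_pred_div (x gamma : R) :
  0 < x -> Rpower x (gamma - 1) / Rpower x gamma = / x.
Proof.
  intros Hx.
  unfold Rminus; rewrite Rpower_plus, Rpower_Ropp, Rpower_1 by exact Hx.
  assert (Hp : 0 < Rpower x gamma) by apply exp_pos.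
  field; lra.
Qed.

Lemma series_converges_tail (u : nat -> R) (N : nat) :
  ex_series (fun k => u (S (N + k))) <-> series_converges u.
Proof.
  symmetry; exact (ex_series_incr_n (fun n => u (S n)) N).
Qed.

(** The partial sums of the differences are [u 0 - u (n+1)], and [u]
    converges because it is decreasing and bounded below. *)
Lemma ex_series_le_decrements (u v : nat -> R) :
  (forall n, 0 <= u n) -> (forall n, 0 <= v n) ->
  (forall n, v n <= u n - u (S n)) -> ex_series v.
Proof.
  intros Hu Hv Huv.
  apply (ex_series_le (K := R_AbsRing) (V := R_CompleteNormedModule)
           v (fun n => u n - u (S n))).
  - intros n; change (Rabs (v n) <= u n - u (S n)).
    rewrite Rabs_pos_eq; auto.
  - assert (Hlim : ex_finite_lim_seq u).
    { apply (ex_finite_lim_seq_decr u 0); auto.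
      intros n; specialize (Hv n); specialize (Huv n); lra. }
    destruct Hlim as [l Hl].
    exists (u O - l).
    change (is_lim_seq (sum_n (fun n => u n - u (S n))) (u O - l)).
    apply is_lim_seq_ext with (fun n => u O - u (S n)).
    + intros n; induction n as [|n IH].
      * now rewrite sum_O.
      * rewrite sum_Sn, <- IH; unfold plus; simpl; ring.
    + apply is_lim_seq_minus'; [apply is_lim_seq_const|].
      now apply (is_lim_seq_incr_1 u).
Qed.

Lemma increasing_from (u : nat -> R) (N : nat) :
  (forall n, (N <= n)%nat -> u n <= u (S n)) ->
  forall k, u N <= u (N + k)%nat.
Proof.
  intros H k; induction k as [|k IH].
  - rewrite Nat.add_0_r; lra.
  - rewrite Nat.add_succ_r; specialize (H (N + k)%nat ltac:(lia)); lra.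
Qed.

(** Division by [x ^ gamma] preserves inequalities, which makes the correction
    term [theta / x ^ gamma] comparable with the terms of order [1 / x]. *)
Lemma threshold_div (x p q gamma : R) :
  0 < x -> p <= q * Rpower x (gamma - 1) -> p / Rpower x gamma <= q / x.
Proof.
  intros Hx H.
  unfold Rdiv at 2; rewrite <- (Rpower_pred_div x gamma Hx).
  unfold Rdiv; rewrite <- Rmult_assoc.
  apply Rmult_le_compat_r; [left; apply Rinv_0_lt_compat, exp_pos | exact H].
Qed.

(** With [x = n], [a' = a (n+1)] and [c' = c (n+1)], this is the ratio condition
    of (i), freed of [mu] and multiplied by [n * a (n+1)]. *)
Lemma decrement_of_ratio (x a a' c' mu theta gamma : R) :
  0 < x -> 0 < a' ->
  theta >= (1 - mu) * Rpower x (gamma - 1) ->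
  a / a' >= 1 + c' / x + mu / x + theta / Rpower x gamma ->
  c' * a' <= x * a - (x + 1) * a'.
Proof.
  intros Hx Ha' Ht Hr.
  assert (Hq : - theta / Rpower x gamma <= - (1 - mu) / x)
    by (apply threshold_div; lra).
  assert (Hs : 1 + c' / x + 1 / x <= a / a').
  { replace (1 / x) with (mu / x - (- (1 - mu) / x)) by (field; lra).
    unfold Rdiv in *; lra. }
  apply Rmult_le_compat_l with (r := x * a') in Hs;
    [|left; now apply Rmult_lt_0_compat].
  replace (x * a' * (1 + c' / x + 1 / x)) with (c' * a' + (x + 1) * a') in Hs
    by (field; lra).
  replace (x * a' * (a / a')) with (x * a) in Hs by (field; lra).
  lra.
Qed.

Lemma increment_of_ratio (x a a' c' mu theta gamma : R) :
  0 < x -> 0 < a' ->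
  theta <= (1 - mu) * Rpower x (gamma - 1) ->
  a / a' <= 1 - c' / x + mu / x + theta / Rpower x gamma ->
  c' * a' <= (x + 1) * a' - x * a.
Proof.
  intros Hx Ha' Ht Hr.
  assert (Hq := threshold_div x theta (1 - mu) gamma Hx Ht).
  assert (Hs : a / a' <= 1 - c' / x + 1 / x).
  { replace (1 / x) with (mu / x + (1 - mu) / x) by (field; lra); lra. }
  apply Rmult_le_compat_l with (r := x * a') in Hs;
    [|left; now apply Rmult_lt_0_compat].
  replace (x * a' * (1 - c' / x + 1 / x)) with ((x + 1) * a' - c' * a') in Hs
    by (field; lra).
  replace (x * a' * (a / a')) with (x * a) in Hs by (field; lra).
  lra.
Qed.

(** The terms are positive, so [ex_series_le_decrements] applies to a tail with
    [u n = n * a n]. *)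
Lemma series_converges_of_decrements (a c : nat -> R) :
  pos_seq a -> pos_seq c ->
  eventually (fun n => c (S n) * a (S n) <= INR n * a n - INR (S n) * a (S n)) ->
  series_converges (fun n => c n * a n).
Proof.
  intros ha hc [N HN].
  (* The start [S N] keeps all indices at least 1, where [a] is positive. *)
  apply (series_converges_tail _ (S N)).
  apply (ex_series_le_decrements
           (fun k => INR (S N + k) * a (S N + k)%nat)).
  - intros k; apply Rmult_le_pos; [apply pos_INR | left; apply ha; lia].
  - intros k; apply Rmult_le_pos; left; [apply hc | apply ha]; lia.
  - intros k; rewrite Nat.add_succ_r; apply HN; lia.
Qed.

(** Part (ii) becomes a direct comparison when read contrapositively: beyond
    some index, [c n / n] is at most [c n * a n / K], where [K] is the value of
    [u n = n * a n] at that index. *)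
Lemma series_converges_div_of_increments (a c : nat -> R) :
  pos_seq a -> pos_seq c ->
  eventually (fun n => c (S n) * a (S n) <= INR (S n) * a (S n) - INR n * a n) ->
  series_converges (fun n => c n * a n) ->
  series_converges (fun n => c n / INR n).
Proof.
  intros ha hc [N HN] Hconv.
  set (u := fun n => INR n * a n).
  set (K := u (S N)).
  assert (HK : 0 < K).
  { apply Rmult_lt_0_compat; [apply lt_0_INR | apply ha]; lia. }
  assert (Hu : forall k, K <= u (S N + k)%nat).
  { apply increasing_from; intros n Hn.
    specialize (HN n ltac:(lia)); fold (u n) (u (S n)) in HN.
    assert (0 < c (S n) * a (S n))
      by (apply Rmult_lt_0_compat; [apply hc | apply ha]; lia).
    lra. }
  apply (series_converges_tail _ N).
  apply (series_converges_tail _ N) in Hconv.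
  apply (ex_series_le (K := R_AbsRing) (V := R_CompleteNormedModule) _
           (fun k => / K * (c (S (N + k)) * a (S (N + k))))).
  - intros k; specialize (Hu k).
    change (S N + k)%nat with (S (N + k)) in Hu.
    set (m := S (N + k)) in *.
    assert (Hm : 0 < INR m) by (apply lt_0_INR; lia).
    assert (Hcm : 0 < c m) by (apply hc; lia).
    change (Rabs (c m / INR m) <= / K * (c m * a m)).
    rewrite Rabs_pos_eq by (left; now apply Rdiv_lt_0_compat).
    replace (c m / INR m) with (c m / (K * INR m) * K) by (field; lra).
    replace (/ K * (c m * a m)) with (c m / (K * INR m) * u m)
      by (unfold u; field; lra).
    apply Rmult_le_compat_l; [left; apply Rdiv_lt_0_compat|]; trivial.
    now apply Rmult_lt_0_compat.
  - exact (ex_series_scal_l (/ K) _ Hconv).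
Qed.

Theorem theorem4p3 (a c theta : nat -> R) (gamma : R)
  (ha : pos_seq a) (hc : pos_seq c) (hgamma : gamma >= 1)
  (htheta : bounded_seq theta) :
  (forall mu : R,
     eventually (fun n : nat =>
       theta n >= (1 - mu) * Rpower (INR n) (gamma - 1)) ->
     eventually (fun n : nat =>
       a n / a (S n) >=
         1 + c (S n) / INR n + mu / INR n + theta n / Rpower (INR n) gamma) ->
     series_converges (fun n : nat => c n * a n))
  /\
  (forall mu : R,
     eventually (fun n : nat =>
       theta n <= (1 - mu) * Rpower (INR n) (gamma - 1)) ->
     series_diverges (fun n : nat => c n / INR n) ->
     eventually (fun n : nat =>
       a n / a (S n) <=
         1 - c (S n) / INR n + mu / INR n + theta n / Rpower (INR n) gamma) ->
     series_diverges (fun n : nat => c n * a n)).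
Proof.
  split.
  - intros mu [N1 H1] [N2 H2].
    apply series_converges_of_decrements; trivial.
    exists (S (N1 + N2)); intros n Hn; rewrite S_INR.
    apply (decrement_of_ratio _ _ _ _ mu (theta n) gamma).
    + apply lt_0_INR; lia.
    + apply ha; lia.
    + apply H1; lia.
    + apply H2; lia.
  - intros mu [N1 H1] Hdiv [N2 H2] Hconv.
    apply Hdiv, (series_converges_div_of_increments a); trivial.
    exists (S (N1 + N2)); intros n Hn; rewrite S_INR.
    apply (increment_of_ratio _ _ _ _ mu (theta n) gamma).
    + apply lt_0_INR; lia.
    + apply ha; lia.
    + apply H1; lia.
    + apply H2; lia.
Qed.
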